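(* Let $\nu^1={\stackrel{*}{\nu}}{}^1+\widetilde\nu{}^1i$ and $\nu^2={\stackrel{*}{\nu}}{}^2+\widetilde\nu{}^2i$ be two eigenvectors of the matrix $B$ corresponding to the complex eigenvalues $\lambda_1={\stackrel{*}{\lambda}}_1+\widetilde\lambda_1i$ and $\lambda_2={\stackrel{*}{\lambda}}_2+\widetilde\lambda_2i$ ($\lambda_1\ne\overline\lambda_2$), respectively, where ${\stackrel{*}{\nu}}{}^\tau={\rm Re}\,\nu^\tau$, $\widetilde\nu{}^\tau={\rm Im}\,\nu^\tau$, ${\stackrel{*}{\lambda}}_\tau={\rm Re}\,\lambda_\tau$, $\widetilde\lambda_\tau={\rm Im}\,\lambda_\tau\ne0$, $\tau=1,2$. Then the system $\dfrac{dx}{dt}=Ax$ has the autonomous first integral $$F\colon x\to\widetilde\lambda_1\arctan\frac{\widetilde\nu{}^2x}{{\stackrel{*}{\nu}}{}^2x}-\widetilde\lambda_2\arctan\frac{\widetilde\nu{}^1x}{{\stackrel{*}{\nu}}{}^1x}\quad\text{for all }x\in\mathscr X,$$ where $\mathscr X\subset\{x\colon{\stackrel{*}{\nu}}{}^2x\ne0\text{ and }{\stackrel{*}{\nu}}{}^1x\ne0\}$ is a domain.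
   Context: $A$ is a real $n\times n$ matrix, $x\in\mathbb R^n$, and $B=A^T$. For a vector $\nu$, $\nu x=\sum_{i=1}^n\nu_ix_i$. A continuously differentiable function $F$ on a domain $\mathscr X\subset\mathbb R^n$ is an autonomous first integral of $dx/dt=Ax$ if $\sum_{i=1}^n(Ax)_i\,\partial_{x_i}F(x)=0$ on $\mathscr X$. *)

(* Defs.v *)
From mathcomp Require Import all_boot all_order all_algebra.
From mathcomp Require Import complex.
From mathcomp Require Import all_classical all_reals all_analysis.

Set Implicit Arguments.
Unset Strict Implicit.
Unset Printing Implicit Defensive.

Import Order.TTheory GRing.Theory Num.Theory.
Import numFieldNormedType.Exports.

Local Open Scope classical_set_scope.
Local Open Scope ring_scope.

Definition domain (T : topologicalType) (X : set T) : Prop :=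
  [/\ X !=set0, open X & connected X].

(* [B] acts on column vectors, whereas [eigenvalue] and [eigenspace] of
   mxalgebra use the action on row vectors. *)
Definition eigenvector (K : fieldType) (n : nat)
    (B : 'M[K]_n) (lambda : K) (nu : 'cV[K]_n) : Prop :=
  nu != 0 /\ B *m nu = lambda *: nu.

Definition complexify (R : realType) (m n : nat)
    (M : 'M[R]_(m, n)) : 'M[R[i]%C]_(m, n) := map_mx (real_complex R) M.

Definition Re_mx (R : realType) (m n : nat)
    (M : 'M[R[i]%C]_(m, n)) : 'M[R]_(m, n) := map_mx (@complex.Re R) M.

Definition Im_mx (R : realType) (m n : nat)
    (M : 'M[R[i]%C]_(m, n)) : 'M[R]_(m, n) := map_mx (@complex.Im R) M.

Definition pairing (R : realType) (n : nat) (nu x : 'cV[R]_n) : R :=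
  \sum_(i < n) nu i 0 * x i 0.

Definition partial (R : realType) (n : nat) (i : 'I_n)
    (F : 'cV[R]_n -> R) (x : 'cV[R]_n) : R :=
  'D_(delta_mx i 0) F x.

(* ['D_v F x] is a total function with an arbitrary value where the limit does
   not exist, so differentiability has to be required separately. *)
Definition continuously_differentiable_on (R : realType) (n : nat)
    (X : set 'cV[R]_n) (F : 'cV[R]_n -> R) : Prop :=
  (forall x, X x -> differentiable F x) /\
  (forall i : 'I_n, {within X, continuous (partial i F)}).

Definition autonomous_first_integral (R : realType) (n : nat)
    (A : 'M[R]_n) (X : set 'cV[R]_n) (F : 'cV[R]_n -> R) : Prop :=
  continuously_differentiable_on X F /\
  (forall x, X x -> \sum_(i < n) (A *m x) i 0 * partial i F x = 0).

(* Main.v *)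
Require Import Defs.
From HB Require Import structures.
From mathcomp Require Import all_boot all_order all_algebra.
From mathcomp Require Import complex.
From mathcomp Require Import all_classical all_reals all_analysis.
From mathcomp Require Import ring.

Import Order.TTheory GRing.Theory Num.Theory.
Import numFieldNormedType.Exports.

Local Open Scope classical_set_scope.
Local Open Scope ring_scope.

(** An eigenvector [nu] of [A^T] gives a complex linear form [z x = nu x] that
    the flow of [dx/dt = A x] multiplies by [exp (lambda t)]. Hence the argument
    of [z x] turns at the constant rate [Im lambda]. Where [Re (z x)] does not
    vanish, [atan (Im (z x) / Re (z x))] is this argument up to a locally
    constant multiple of [pi], so it grows at the same rate. With two such
    eigenvectors the rates are [Im lambda1] and [Im lambda2], and weighting each
    angle by the rate of the other makes the two growths cancel.

    [angle_form_flow] is the statement on the rate: the angular form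
    [(p dq - q dp) / (p ^+ 2 + q ^+ 2)] takes the value [Im lambda] on [A x],
    because of the real equations contained in [nu^T A = lambda nu^T]
    ([pairing_eigenvector]). [is_diff_angle] identifies this form as the
    differential of the angle. Its coefficients are continuous where [p] is
    nonzero, which gives the continuity of the partial derivatives. *)

Set Implicit Arguments.
Unset Strict Implicit.
Unset Printing Implicit Defensive.

(** * Differentials and linear forms *)

Lemma pairing_is_linear (R : realType) (n : nat) (nu : 'cV[R]_n) :
  linear (pairing nu : 'cV[R]_n -> R).
Proof.
move=> a u v; rewrite /pairing scaler_sumr -big_split /=.
by apply: eq_bigr => i _; rewrite !mxE /GRing.scale /=; ring.
Qed.

HB.instance Definition _ (R : realType) (n : nat) (nu : 'cV[R]_n) :=
  GRing.isLinear.Build R 'cV[R]_n R *%R (pairing nu)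
    (@pairing_is_linear R n nu).

Lemma continuous_pairing (R : realType) (n : nat) (nu : 'cV[R]_n) :
  continuous (pairing nu : 'cV[R]_n -> R).
Proof.
apply: continuous_big; first exact: add_continuous.
move=> i _ x.
apply: (@continuousM _ _ (fun=> nu i 0) (fun y : 'cV[R]_n => y i 0)).
  exact: cst_continuous.
exact: coord_continuous.
Qed.

Lemma is_diff_pairing (R : realType) (n : nat) (nu x : 'cV[R]_n) :
  is_diff x (pairing nu : 'cV[R]_n -> R) (pairing nu).
Proof.
have c := @continuous_pairing R n nu.
apply: DiffDef; first exact: linear_differentiable.
exact: diff_lin.
Qed.

(** The derivative of [F] along a vector field is the value of its differential
    on the field, so that it can be computed without coordinates. *)
Lemma sum_partial (R : realType) (n : nat) (F : 'cV[R]_n -> R)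
    (x v : 'cV[R]_n) :
  differentiable F x -> \sum_(i < n) v i 0 * partial i F x = 'd F x v.
Proof.
move=> dF.
have {2}-> : v = \sum_(i < n) v i 0 *: delta_mx i 0.
  by rewrite {1}[v]matrix_sum_delta; apply: eq_bigr => i _; rewrite big_ord1.
rewrite linear_sum; apply: eq_bigr => i _.
by rewrite /partial deriveE // linearZ.
Qed.

(** * The angular form *)

Lemma addr_sqr_neq0 (R : realDomainType) (p q : R) :
  p != 0 -> p ^+ 2 + q ^+ 2 != 0.
Proof.
by move=> p0; rewrite paddr_eq0 ?sqr_ge0 // !sqrf_eq0 (negbTE p0).
Qed.

Lemma is_diff_atan_ratio (R : realType) (V : normedModType R)
    (p q dp dq : V -> R) (x : V) :
    p x != 0 -> is_diff x p dp -> is_diff x q dq ->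
  is_diff x (fun y => atan (q y / p y))
    (fun v => (p x * dq v - q x * dp v) / (p x ^+ 2 + q x ^+ 2)).
Proof.
move=> px0 hp hq.
have hV : is_diff x (fun y => (p y)^-1) (- (p x) ^- 2 \*: dp).
  apply: DiffDef; first exact/differentiableV.
  by rewrite diffV // diff_val.
have hA : is_diff (q x / p x) (atan : R -> R)
    (fun h => h *: (1 + (q x / p x) ^+ 2)^-1).
  have dA := is_derive1_atan (q x / p x).
  have dfA : differentiable (atan : R -> R) (q x / p x).
    by apply/derivable1_diffP; exact: ex_derive.
  by apply: DiffDef => //; rewrite diff1E // derive1E derive_val.
have hM : is_diff x (fun y => q y / p y) _ := is_diffM hq hV.
apply: is_diff_eq (is_diff_comp hM hA) _.
have n0 := addr_sqr_neq0 (q x) px0.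
apply/funext => v /=.
transitivity ((q x * (- p x ^- 2 * dp v) + (p x)^-1 * dq v)
  / (1 + (q x / p x) ^+ 2)) => //.
by field; rewrite px0 n0 /=.
Qed.

(** The pull-back of the angular form of the plane by [(pairing a, pairing b)],
    at the point [x], evaluated on [v]. *)
Definition angle_form (R : realType) (n : nat) (a b x v : 'cV[R]_n) : R :=
  (pairing a x * pairing b v - pairing b x * pairing a v)
    / (pairing a x ^+ 2 + pairing b x ^+ 2).

Lemma is_diff_angle (R : realType) (n : nat) (a b x : 'cV[R]_n) :
  pairing a x != 0 ->
  is_diff x (fun y : 'cV[R]_n => atan (pairing b y / pairing a y))
    (angle_form a b x).
Proof.
move=> ax; apply: is_diff_atan_ratio => //; exact: is_diff_pairing.
Qed.

Lemma continuous_angle_form (R : realType) (n : nat) (a b x v : 'cV[R]_n) :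
  pairing a x != 0 -> {for x, continuous (fun y => angle_form a b y v)}.
Proof.
move=> ax.
have cp (c : 'cV[R]_n) : {for x, continuous (pairing c : 'cV[R]_n -> R)}.
  exact: continuous_pairing.
have cpk (c : 'cV[R]_n) (k : R) :
    {for x, continuous (fun y : 'cV[R]_n => pairing c y * k)}.
  by apply: continuousM; [exact: cp | exact: cst_continuous].
apply: continuousM; first by apply: continuousB; exact: cpk.
apply: continuousV; first exact: addr_sqr_neq0.
by apply: continuousD; apply: continuousM; exact: cp.
Qed.

(** * Eigenvectors of the transpose *)

(** The real and imaginary parts of [nu (A x) = lambda (nu x)]: in the plane
    with coordinates [Re nu] and [Im nu], the matrix [A] acts as the
    multiplication by [lambda]. *)
Lemma pairing_eigenvector (R : realType) (n : nat) (A : 'M[R]_n)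
    (l : R[i]%C) (nu : 'cV[R[i]%C]_n) (x : 'cV[R]_n) :
  eigenvector (complexify A^T) l nu ->
  pairing (Re_mx nu) (A *m x) =
    complex.Re l * pairing (Re_mx nu) x - complex.Im l * pairing (Im_mx nu) x /\
  pairing (Im_mx nu) (A *m x) =
    complex.Im l * pairing (Re_mx nu) x + complex.Re l * pairing (Im_mx nu) x.
Proof.
move=> [_ e].
have tr (mu : 'cV[R]_n) : pairing mu (A *m x) = pairing (A^T *m mu) x.
  have pE (u y : 'cV[R]_n) : pairing u y = (u^T *m y) 0 0.
    by rewrite mxE; apply: eq_bigr => i _; rewrite mxE.
  by rewrite !pE trmx_mul trmxK mulmxA.
have eRe : A^T *m Re_mx nu =
    complex.Re l *: Re_mx nu - complex.Im l *: Im_mx nu.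
  apply/matrixP => i j; move/matrixP/(_ i j): e.
  move/(congr1 (@complex.Re R)); rewrite !mxE raddf_sum /=.
  have -> : complex.Re (l * nu i j) = complex.Re l * complex.Re (nu i j)
    - complex.Im l * complex.Im (nu i j) by case: (l) (nu i j) => a b [c d].
  move=> <-; apply: eq_bigr => k _; rewrite !mxE.
  by case: (nu k j) => c d /=; rewrite mul0r subr0.
have eIm : A^T *m Im_mx nu =
    complex.Im l *: Re_mx nu + complex.Re l *: Im_mx nu.
  apply/matrixP => i j; move/matrixP/(_ i j): e.
  move/(congr1 (@complex.Im R)); rewrite !mxE raddf_sum /=.
  have -> : complex.Im (l * nu i j) = complex.Im l * complex.Re (nu i j)
    + complex.Re l * complex.Im (nu i j).
    by case: (l) (nu i j) => a b [c d] /=; ring.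
  move=> <-; apply: eq_bigr => k _; rewrite !mxE.
  by case: (nu k j) => c d /=; rewrite mul0r addr0.
rewrite !tr eRe eIm.
have pl a b (u w : 'cV[R]_n) :
    pairing (a *: u + b *: w) x = a * pairing u x + b * pairing w x.
  rewrite /pairing !mulr_sumr -big_split /=; apply: eq_bigr => i _.
  by rewrite !mxE; ring.
by rewrite -scaleNr !pl mulNr.
Qed.

(** Multiplying [z] by [lambda] moves it with radial speed [Re lambda * |z|] and
    angular speed [Im lambda]: the real part contributes only in the radial
    direction, on which the angular form vanishes. *)
Lemma angle_form_flow (R : realType) (n : nat) (A : 'M[R]_n)
    (l : R[i]%C) (nu : 'cV[R[i]%C]_n) (x : 'cV[R]_n) :
  eigenvector (complexify A^T) l nu -> pairing (Re_mx nu) x != 0 ->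
  angle_form (Re_mx nu) (Im_mx nu) x (A *m x) = complex.Im l.
Proof.
move=> /pairing_eigenvector h; rewrite /angle_form; have [-> ->] := h x.
move: (pairing _ _) (pairing _ _) => q p p0.
have n0 := addr_sqr_neq0 q p0.
by field.
Qed.

Unset Implicit Arguments.

(** * The first integral *)

Theorem theorem3p5 (R : realType) (n : nat) (A : 'M[R]_n)
    (nu1 nu2 : 'cV[R[i]%C]_n) (lambda1 lambda2 : R[i]%C)
    (hnu1 : eigenvector (complexify A^T) lambda1 nu1)
    (hnu2 : eigenvector (complexify A^T) lambda2 nu2)
    (hlambda : lambda1 <> (lambda2^*)%C)
    (him1 : complex.Im lambda1 <> 0)
    (him2 : complex.Im lambda2 <> 0)
    (X : set 'cV[R]_n)
    (hX : domain X)
    (hXsub : X `<=` [set x | pairing (Re_mx nu2) x <> 0 /\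
                             pairing (Re_mx nu1) x <> 0]) :
  autonomous_first_integral A X
    (fun x : 'cV[R]_n =>
       complex.Im lambda1 *
         atan (pairing (Im_mx nu2) x / pairing (Re_mx nu2) x)
       - complex.Im lambda2 *
         atan (pairing (Im_mx nu1) x / pairing (Re_mx nu1) x)).
Proof.
have nz1 x : X x -> pairing (Re_mx nu1) x != 0.
  by move=> /hXsub[_ ?]; apply/eqP.
have nz2 x : X x -> pairing (Re_mx nu2) x != 0.
  by move=> /hXsub[? _]; apply/eqP.
set F := (F in autonomous_first_integral A X F).
pose dF x v := complex.Im lambda1 * angle_form (Re_mx nu2) (Im_mx nu2) x v
  - complex.Im lambda2 * angle_form (Re_mx nu1) (Im_mx nu1) x v.
have hF x : X x -> is_diff x F (dF x).
  move=> Xx.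
  exact: is_diffB (is_diffZ (complex.Im lambda1)
                     (is_diff_angle (Im_mx nu2) (nz2 x Xx)))
                  (is_diffZ (complex.Im lambda2)
                     (is_diff_angle (Im_mx nu1) (nz1 x Xx))).
have diffF x : X x -> differentiable F x by move=> /hF[].
split; first (split => // i).
  have cdF : {within X, continuous (dF ^~ (delta_mx i 0))}.
    apply: continuous_in_subspaceT => x /set_mem Xx.
    apply: (@continuousB _ _ _
        (fun y => complex.Im lambda1 * angle_form (Re_mx nu2) (Im_mx nu2) y _)
        (fun y => complex.Im lambda2 * angle_form (Re_mx nu1) (Im_mx nu1) y _));
      apply: continuousM; try exact: cst_continuous.
      exact: continuous_angle_form (nz2 x Xx).
    exact: continuous_angle_form (nz1 x Xx).
  apply: (subspace_eq_continuous _ cdF) => x /set_mem Xx.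
  have hFx := hF x Xx; change (dF x (delta_mx i 0) = partial i F x).
  by rewrite /partial (deriveE _ (diffF x Xx)) diff_val.
move=> x Xx; have hFx := hF x Xx.
rewrite sum_partial ?diff_val; last exact: diffF.
rewrite /dF (angle_form_flow hnu1 (nz1 x Xx)) (angle_form_flow hnu2 (nz2 x Xx)).
by rewrite mulrC subrr.
Qed.
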